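(* For every integer $n\geq 16$, $$\operatorname{ex}_{\mathcal{H}}(n,C_4)=\begin{cases}\frac{5}{3}(n-1), & 3\mid (n-1),\\[2pt] \frac{5}{3}(n-2)+1, & 3\mid (n-2),\\[2pt] \frac{5}{3}(n-3)+3, & 3\mid (n-3).\end{cases}$$
   Context: A Halin graph $H$ is a graph (on at least four vertices) constructed as follows: start with a tree $T$ in which every non-leaf vertex has degree at least $3$; embed $T$ in the plane in a planar fashion; then add new edges forming a cycle $C$ through all the leaves of $T$ (the vertices of $C$ are exactly the leaves of $T$) in such a way that the resulting graph $H=T\cup C$ is planar, with $C$ bounding the outer face. A graph is $F$-free if it contains no subgraph (not necessarily induced) isomorphic to $F$. $C_4$ is the cycle of length $4$; $e(H)$ is the number of edges of $H$. The Halin Turán number is $\operatorname{ex}_{\mathcal{H}}(n,F)=\max\{e(H): H \text{ is an } n\text{-vertex } F\text{-free Halin graph}\}$. *)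

(* Defs.v *)
From mathcomp Require Import all_boot all_fingroup.
From mathcomp Require Import boolp.

Set Implicit Arguments.
Unset Strict Implicit.
Unset Printing Implicit Defensive.

(** Finite simple graphs on a finite vertex type [V] are sets of two-element
    subsets of [V]; the number of edges of [G] is [#|G|]. *)

Definition simple_graph (V : finType) (G : {set {set V}}) : Prop :=
  forall A, A \in G -> #|A| = 2.

Definition adj (V : finType) (G : {set {set V}}) : rel V :=
  fun x y => [set x; y] \in G.

Definition degree (V : finType) (G : {set {set V}}) (x : V) : nat :=
  #|[set A in G | x \in A]|.

Definition leaf (V : finType) (G : {set {set V}}) : pred V :=
  fun x => degree G x == 1.

Definition connected (V : finType) (G : {set {set V}}) : Prop :=
  0 < #|V| /\ forall x y : V, connect (adj G) x y.

Definition tree (V : finType) (T : {set {set V}}) : Prop :=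
  [/\ simple_graph T, connected T &
      forall c : seq V, 2 < size c -> ~ ucycle (adj T) c].

(** The edge set of the closed walk through the cyclic sequence [c]; it is a
    cycle when [c] is duplicate-free and has at least three elements. *)
Definition cycle_edges (V : finType) (c : seq V) : {set {set V}} :=
  [set [set x; next c x] | x in c].

(** A rotation system: [rot x] permutes the neighbours of [x] in a single
    cycle, giving their (say clockwise) order around [x].  The values of [rot x]
    outside the neighbourhood of [x] are irrelevant. *)
Definition rotation_system (V : finType) (G : {set {set V}})
    (rot : V -> {perm V}) : Prop :=
  forall x y, adj G x y -> porbit (rot x) y = [set z | adj G x z].

(** Facial walks are the orbits of this map on the darts (ordered pairs of
    adjacent vertices): after traversing [x] to [y], leave [y] along the edge
    that follows [yx] in the rotation at [y]. *)
Definition face_step (V : finType) (rot : V -> {perm V}) (d : V * V) : V * V :=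
  (d.2, rot d.2 d.1).

Definition nb_faces (V : finType) (G : {set {set V}})
    (rot : V -> {perm V}) : nat :=
  fcard (face_step rot) [pred d : V * V | adj G d.1 d.2].

(** Embeddings of a connected graph (with an edge) in the plane, up to
    homeomorphism of the sphere, are the rotation systems of genus 0, i.e. those
    for which |V| - |E| + |F| = 2. *)
Definition plane_embedding (V : finType) (G : {set {set V}})
    (rot : V -> {perm V}) : Prop :=
  [/\ connected G, rotation_system G rot & #|V| + nb_faces G rot = #|G| + 2].

(** The cyclic sequence [c], with its orientation, is a facial walk.  Any face
    of an embedding in the sphere can be taken as the outer face. *)
Definition bounds_face (V : finType) (rot : V -> {perm V}) (c : seq V) : Prop :=
  fcycle (face_step rot) [seq (x, next c x) | x <- c].

(** The embedding of [T] is the one induced by the embedding of [H]. *)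
Definition halin (V : finType) (H : {set {set V}}) : Prop :=
  4 <= #|V| /\
  exists (T : {set {set V}}) (c : seq V),
    [/\ tree T /\ (forall x, ~~ leaf T x -> 3 <= degree T x),
        [/\ uniq c, 2 < size c & c =i leaf T],
        [disjoint T & cycle_edges c],
        H = T :|: cycle_edges c
      & exists rot : V -> {perm V}, plane_embedding H rot /\ bounds_face rot c].

Definition contains_copy (U V : finType) (F : {set {set U}})
    (G : {set {set V}}) : Prop :=
  exists f : U -> V, injective f /\ forall A, A \in F -> f @: A \in G.

Definition free_of (U V : finType) (F : {set {set U}})
    (G : {set {set V}}) : Prop := ~ contains_copy F G.

Definition cycle_graph (k : nat) : {set {set 'I_k}} :=
  [set [set i; ordS i] | i : 'I_k].

(** Every n-vertex graph is isomorphic to one on ['I_n].  The maximum over an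
    empty family is 0, so a positive value is attained. *)
Definition halin_ex (n : nat) (U : finType) (F : {set {set U}}) : nat :=
  \max_(H : {set {set 'I_n}} | `[< halin H /\ free_of F H >]) #|H|.

(* Main.v *)
Require Import Defs.
From mathcomp Require Import all_boot all_fingroup.
From mathcomp Require Import boolp zify.

Set Implicit Arguments.
Unset Strict Implicit.
Unset Printing Implicit Defensive.

(** A Halin graph [H] on [n] vertices whose cycle [c] has [l] vertices has
    [n - 1 + l] edges, so the question is how many leaves the tree can have; the
    answer is the integer part of [2 (n - 1) / 3].

    Upper bound.  In an embedding with outer face [c], a face that avoids the
    edges of [c] would be traced by a closed walk in the tree that never turns
    back, which is impossible.  Hence each inner face contains one of the [l]
    backward darts [(next c x, x)].  By Euler's formula there are exactly [l] inner
    faces, so the face of [(next c x, x)] contains no other backward dart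
    ([plane_tree_card]).  Without four-cycles its length [f x] is 3 or at least
    5, and two triangles cannot follow each other around [c]: three consecutive
    leaves with the same parent [p] form a four-cycle with [p].  Therefore
    [8 <= f x + f (next c x)] ([adjacent_face_lengths]).  Since the inner faces
    have at most [2 * #|H| - l] darts in total, summing gives
    [3 l <= 2 (n - 1)] ([plane_C4free_leaves]).

    Lower bound.  Equality, up to rounding, asks for triangles that alternate
    with pentagons: the leaves come in pairs of siblings (cherries), and
    consecutive pairs have parents at distance 2.  A hub joined to many cherries
    does this when 3 divides [n - 1].  For the other residues a small piece of
    tree is attached to the hub first: a second hub with two cherries when 3
    divides [n - 2]; and when 3 divides [n - 3], a vertex that carries a single
    leaf, a second hub with two cherries, and a pair of leaves, in this order.

    To treat the three families together, a plane tree is given by the parent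
    function of a preorder numbering of its vertices ([Section Preorder]).  Such
    a tree comes with a rotation at every vertex.  The induced graph [H] is
    plane because a label of the corners, the number of leaves that precede the
    corner in preorder, is constant along the inner faces and separates the
    darts [(next c x, x)] ([preorder_faces]).  A four-cycle in [H] lies above
    two or three consecutive leaves ([halin_C4free]), so its absence is a
    condition on the parents of consecutive leaves; in the three families this
    condition repeats from one cherry to the next ([extremal_graph]). *)

(** * Graphs, degrees and trees *)

Section Graphs.
Variables (V : finType) (G : {set {set V}}).

Lemma adj_sym x y : adj G x y = adj G y x.
Proof. by rewrite /adj setUC. Qed.

Hypothesis simpleG : simple_graph G.

Lemma adj_neq x y : adj G x y -> x != y.
Proof. by move=> /simpleG; rewrite cards2; case: (x != y). Qed.

Lemma degree_card_adj x : degree G x = #|[set y | adj G x y]|.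
Proof.
rewrite -(card_in_imset (f := fun y => [set x; y])); last first.
  move=> y z; rewrite !inE => /adj_neq nxy /adj_neq nxz exyz.
  have: y \in [set x; z] by rewrite -exyz !inE eqxx orbT.
  by rewrite !inE eq_sym (negPf nxy) => /eqP.
apply: eq_card => A; rewrite !inE; apply/andP/imsetP => [[GA xA]|[y]].
  have /cards2P[a [b [nab defA]]] : #|A| == 2 by rewrite simpleG.
  move: xA; rewrite defA !inE => /orP[]/eqP xE.
    by exists b; rewrite ?inE /adj xE // -defA.
  by exists a; rewrite ?inE /adj xE setUC // -defA.
by rewrite inE => Gxy ->; rewrite !inE eqxx.
Qed.

Lemma card_darts : #|[pred d : V * V | adj G d.1 d.2]| = 2 * #|G|.
Proof.
transitivity (\sum_x degree G x).
  rewrite -sum1_card (eq_bigl (fun d => true && adj G d.1 d.2)) //.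
  rewrite -(pair_big_dep xpredT (fun x y => adj G x y) (fun _ _ => 1)) /=.
  apply: eq_bigr => x _; rewrite degree_card_adj -sum1_card.
  by apply: eq_bigl => y; rewrite inE.
rewrite /degree (eq_bigr (fun x => \sum_(A in G | x \in A) 1)); last first.
  by move=> x _; rewrite -sum1_card; apply: eq_bigl => A; rewrite inE.
rewrite (exchange_big_dep (mem G)) /=; last by move=> x A _ /andP[].
rewrite mulnC -sum_nat_const; apply: eq_bigr => A GA.
by rewrite -(simpleG GA) -sum1_card; apply: eq_bigl => x; rewrite GA.
Qed.

End Graphs.

(** Rooting the graph and sending each other vertex to an edge that leads one
    step closer to the root is injective. *)
Lemma connected_card (V : finType) (G : {set {set V}}) :
  simple_graph G -> connected G -> #|V| <= #|G| + 1.
Proof.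
move=> sG [/card_gt0P[r _] conn].
have walk x : exists k, [exists p : k.-tuple V, path (adj G) r p && (last r p == x)].
  have /connectP[p rp ->] := conn r x; exists (size p).
  by apply/existsP; exists (in_tuple p); rewrite rp eqxx.
pose dist x := ex_minn (walk x).
have closer x : x != r -> exists y, adj G y x && (dist y < dist x).
  move=> nxr; rewrite {2}/dist; case: ex_minnP => k /existsP[[p /= /eqP sp]].
  case/lastP: p sp => [|p z] sp /andP[rp /eqP lx] _.
    by rewrite -lx eqxx in nxr.
  move: rp lx sp; rewrite rcons_path last_rcons size_rcons => /andP[rp pz] zx <-.
  exists (last r p); rewrite -zx pz ltnS /dist; case: ex_minnP => m _; apply.
  by apply/existsP; exists (in_tuple p); rewrite rp eqxx.
pose up x := odflt r [pick y | adj G y x && (dist y < dist x)].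
have upP x : x != r -> adj G (up x) x && (dist (up x) < dist x).
  move=> /closer[y yx]; rewrite /up; case: pickP => [//|/(_ y)].
  by rewrite yx.
rewrite (cardD1 r) inE addnC leq_add2r.
rewrite -(card_in_imset (f := fun x => [set up x; x])); last first.
  move=> x y; rewrite !inE !andbT => /upP/andP[_ ux] /upP/andP[_ uy] exy.
  have: x \in [set up y; y] by rewrite -exy !inE eqxx orbT.
  have: y \in [set up x; x] by rewrite exy !inE eqxx orbT.
  rewrite !inE => /orP[/eqP ey|/eqP //] /orP[/eqP ex|/eqP //].
  by move: ux uy; rewrite -ey -ex => /ltnW; rewrite leqNgt => /negPf->.
apply/subset_leq_card/subsetP => A /imsetP[x]; rewrite inE andbT => nxr ->.
by have /andP[] := upP x nxr.
Qed.

(** An infinite walk in a finite graph revisits a vertex; between two visits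
    that are as close as possible it runs through a cycle. *)
Lemma tree_backtrack (V : finType) (T : {set {set V}}) (v : nat -> V) :
    tree T -> (forall i, adj T (v i) (v i.+1)) ->
  exists i, v i.+2 = v i.
Proof.
move=> [sT _ acyT] vT; apply: contrapT => noback.
have rep : exists d, `[< 0 < d /\ exists i, v i = v (i + d) >].
  have /injectivePn[x [y nxy vxy]] : ~~ injectiveb (fun i : 'I_#|V|.+1 => v i).
    apply/injectiveP => /leq_card; rewrite card_ord; by rewrite ltnn.
  wlog ltxy : x y nxy vxy / x < y.
    move=> th; case: (ltngtP x y) => [/th|/th|/val_inj/eqP]; last by rewrite (negPf nxy).
      exact.
    by apply; rewrite // eq_sym.
  exists (y - x); apply/asboolP; split; first by rewrite subn_gt0.
  by exists x; rewrite subnKC // ltnW.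
case: (ex_minnP rep) => d /asboolP[d_gt0 [i vi]] dmin.
have loop j k : 0 < k -> v j = v (j + k) -> d <= k.
  by move=> k0 vj; apply/dmin/asboolP; split=> //; exists j.
have d_gt2 : 2 < d.
  case: d d_gt0 vi {dmin loop} => [//|[|[|//]]] _ vi.
    by have := adj_neq sT (vT i); rewrite {1}vi addn1 eqxx.
  by case: noback; exists i; rewrite vi addn2.
case: (acyT [seq v k | k <- iota i d]); first by rewrite size_map size_iota.
apply/andP; split.
  case: d d_gt0 vi {dmin loop d_gt2} => [//|d] _ vi /=.
  rewrite rcons_path; apply/andP; split.
    by elim: d {vi} i => //= d IH i; rewrite vT IH.
  rewrite last_map.
  have -> : last i (iota i.+1 d) = i + d.
    by elim: d {vi} i => [|d IH] i /=; rewrite ?addn0 // IH addSnnS.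
  by rewrite vi addnS vT.
rewrite map_inj_in_uniq ?iota_uniq // => a b; rewrite !mem_iota.
wlog ltab : a b / a < b.
  move=> th; case: (ltngtP a b) => [/th|/th h pa pb e|//]; first exact.
  by rewrite (h pb pa).
move=> /andP[ia _] /andP[_ bd] vab.
have := @loop a (b - a); rewrite subn_gt0 subnKC ?(ltnW ltab) // => /(_ ltab vab).
by lia.
Qed.

Lemma four_cycle_copy (V : finType) (G : {set {set V}}) a b c d :
    simple_graph G -> adj G a b -> adj G b c -> adj G c d -> adj G d a ->
  a != c -> b != d -> contains_copy (cycle_graph 4) G.
Proof.
move=> sG ab bc cd da ac bd; pose t := [tuple a; b; c; d].
exists (tnth t); split.
  apply/tuple_uniqP; rewrite /= !inE !negb_or ac bd (adj_neq sG ab) (adj_neq sG bc).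
  by rewrite (adj_neq sG cd) eq_sym (adj_neq sG da).
move=> A /imsetP[i _ ->]; rewrite imsetU1 imset_set1 !(tnth_nth a) /=.
by case: i => [[|[|[|[|]]]]].
Qed.

(** * Cycles *)

Section Cycles.
Variables (V : finType) (c : seq V).
Hypotheses (uniq_c : uniq c) (size_c : 2 < size c).

Let nx := next c.

Lemma cycle_start x : x \in c -> exists y z p,
  [/\ uniq [:: x, y, z & p], nx x = y & nx y = z].
Proof.
move=> xc; have [i p def_c] := rot_to xc.
have := size_c; rewrite -(size_rot i) def_c.
case: p def_c => [|y [|z p]] // def_c _; exists y, z, p.
have u : uniq [:: x, y, z & p] by rewrite -def_c rot_uniq.
split=> //; rewrite /nx -(next_rot i) // def_c /=; first by rewrite eqxx.
have /negPf-> : y != x by move: u => /= /andP[]; rewrite inE negb_or eq_sym => /andP[].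
by rewrite eqxx.
Qed.

Lemma next_neq x : x \in c -> nx x != x.
Proof.
move=> /cycle_start[y [z [p [/= /andP[xN _] -> _]]]].
by move: xN; rewrite inE negb_or eq_sym => /andP[].
Qed.

Lemma next2_neq x : x \in c -> nx (nx x) != x.
Proof.
move=> /cycle_start[y [z [p [/= /andP[xN _] -> ->]]]].
by move: xN; rewrite !inE !negb_or => /and3P[_]; rewrite eq_sym.
Qed.

Lemma next_inj : injective nx.
Proof. exact: can_inj (prev_next uniq_c). Qed.

Lemma next_neq_prev x : x \in c -> nx x != prev c x.
Proof.
move=> xc; apply/eqP => e; have := @next2_neq (prev c x).
by rewrite mem_prev xc /nx next_prev // -/(nx x) e eqxx => /(_ isT).
Qed.

Lemma adj_cycle x y :
  adj (cycle_edges c) x y = (x \in c) && (y == nx x) || (y \in c) && (x == nx y).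
Proof.
apply/imsetP/orP => [[z zc exy]|[]/andP[xc /eqP->]]; last 2 first.
- by exists x.
- by exists y; rewrite // setUC.
have nz := next_neq zc.
have: x \in [set z; next c z] by rewrite -exy !inE eqxx.
have: y \in [set z; next c z] by rewrite -exy !inE eqxx orbT.
have: z \in [set x; y] by rewrite exy !inE eqxx.
have: next c z \in [set x; y] by rewrite exy !inE eqxx orbT.
rewrite !inE => n1 z1 /orP[/eqP yz|/eqP yz] /orP[/eqP xz|/eqP xz]; subst x y.
- by move: n1; rewrite orbb (negPf nz).
- by right; rewrite zc eqxx.
- by left; rewrite zc eqxx.
- by move: z1; rewrite orbb eq_sym (negPf nz).
Qed.

Lemma card_cycle_edges : #|cycle_edges c| = size c.
Proof.
rewrite card_in_imset ?(card_uniqP uniq_c) // => x y xc yc exy.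
have: x \in [set y; next c y] by rewrite -exy !inE eqxx.
have: y \in [set x; next c x] by rewrite exy !inE eqxx.
rewrite !inE => /orP[/eqP //|/eqP y1] /orP[/eqP //|/eqP x1].
by have := next2_neq xc; rewrite /nx -y1 -x1 eqxx.
Qed.

Lemma simple_cycle_edges : simple_graph (cycle_edges c).
Proof. by move=> A /imsetP[x xc ->]; rewrite cards2 eq_sym next_neq. Qed.

End Cycles.

(** * Faces of a Halin graph *)

Section Faces.
Variables (V : finType) (T : {set {set V}}) (c : seq V) (rot : V -> {perm V}).
Hypotheses (treeT : tree T) (degT : forall x, ~~ leaf T x -> 3 <= degree T x).
Hypotheses (uniq_c : uniq c) (size_c : 2 < size c) (mem_c : c =i leaf T).
Hypothesis disjTC : [disjoint T & cycle_edges c].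
Let H := T :|: cycle_edges c.
Hypotheses (rotH : rotation_system H rot) (outer : bounds_face rot c).
Let nx := next c.
Let pv := prev c.

Lemma halin_simple : simple_graph H.
Proof.
have [sT _ _] := treeT.
by move=> A; rewrite inE => /orP[/sT|/(simple_cycle_edges uniq_c size_c)].
Qed.

Lemma halin_adjE x y : adj H x y = adj T x y || adj (cycle_edges c) x y.
Proof. by rewrite /adj inE. Qed.

Lemma tree_adj_cycle x y : adj T x y -> adj (cycle_edges c) x y = false.
Proof. by move=> Txy; apply: (disjointFr disjTC). Qed.

Lemma adj_next x : x \in c -> adj H x (nx x).
Proof. by move=> xc; rewrite halin_adjE adj_cycle // xc eqxx orbT. Qed.

Lemma adj_prev x : x \in c -> adj H x (pv x).
Proof. by move=> xc; rewrite halin_adjE adj_cycle // mem_prev xc next_prev // eqxx !orbT. Qed.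

Lemma leaf_adj_unique x : x \in c ->
  exists p, forall y, adj T x y = (y == p).
Proof.
have [sT _ _] := treeT.
rewrite mem_c [_ \in _]/(leaf T x) /leaf degree_card_adj // => /cards1P[p e].
by exists p => y; move/setP/(_ y): e; rewrite !inE.
Qed.

(** A leaf has two neighbours on the cycle besides the one in the tree. *)
Lemma halin_degree x : 3 <= #|[set y | adj H x y]|.
Proof.
have [sT _ _] := treeT; have [xc|xNc] := boolP (x \in c); last first.
  apply: leq_trans (_ : degree T x <= _); first by apply: degT; move: xNc; rewrite mem_c.
  rewrite degree_card_adj //; apply/subset_leq_card/subsetP => y.
  by rewrite !inE halin_adjE => ->.
have [p xp] := leaf_adj_unique xc.
have Txp : adj T x p by rewrite xp.
have : [set p; nx x; pv x] \subset [set y | adj H x y].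
  apply/subsetP => y; rewrite !inE => /orP[/orP[]|] /eqP->.
  - by rewrite halin_adjE Txp.
  - exact: adj_next.
  - exact: adj_prev.
move=> /subset_leq_card; apply: leq_trans.
have /negPf pn : p != nx x.
  apply/eqP => e; have := tree_adj_cycle Txp.
  by rewrite adj_cycle // xc e eqxx.
have /negPf pp : p != pv x.
  apply/eqP => e; have := tree_adj_cycle Txp.
  by rewrite adj_cycle // e mem_prev xc next_prev // eqxx orbT.
by rewrite setUAC setUC cardsU1 cards2 !inE eq_sym pn (negPf (next_neq_prev uniq_c size_c xc)) pp.
Qed.

Lemma rot_adj x y : adj H x y -> adj H x (rot x y).
Proof. by move=> /rotH e; have := mem_porbit (rot x) 1 y; rewrite e inE expg1. Qed.

(** The orbit of [y] would otherwise have at most two of the three or more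
    neighbours of [x]. *)
Lemma rot_not_involutive x y : adj H x y -> rot x (rot x y) != y.
Proof.
move=> /rotH e; apply/eqP => inv; have := halin_degree x; rewrite -e.
have : porbit (rot x) y \subset [set y; rot x y].
  apply/subsetP => z /porbitP[i ->]; rewrite permX.
  elim: i => [|i]; first by rewrite !inE eqxx.
  by rewrite iterS !inE => /orP[]/eqP ->; rewrite ?inv eqxx ?orbT.
by move=> /subset_leq_card; rewrite cards2; case: (_ != _) => /=; lia.
Qed.

Lemma rot_neq x y : adj H x y -> rot x y != y.
Proof. by move=> /rot_not_involutive; apply: contraNneq => e; rewrite !e. Qed.

Lemma rot_outer x : x \in c -> rot (nx x) x = nx (nx x).
Proof.
move=> xc; have /next_cycle/(_ (map_f _ xc)) := outer.
rewrite next_map //; last by move=> y z [].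
by move=> /eqP[].
Qed.

Lemma rot_prev x : x \in c -> rot x (pv x) = nx x.
Proof.
by move=> xc; have := @rot_outer (pv x); rewrite mem_prev /nx /pv !next_prev // => /(_ xc).
Qed.

(** At a leaf the rotation sends the previous vertex of the cycle to the next
    one, which it then has to send to the third neighbour. *)
Lemma rot_next_tree x : x \in c -> adj T x (rot x (nx x)).
Proof.
move=> xc; have xn := adj_next xc.
move: (rot_adj xn); rewrite halin_adjE => /orP[//|].
rewrite adj_cycle // xc (negPf (rot_neq xn)) /= => /andP[_ /eqP e].
have := rot_not_involutive xn; have := prev_next uniq_c (rot x (nx x)).
by rewrite -e => {1}<-; rewrite rot_prev // eqxx.
Qed.

(** The mirror image of [rot_next_tree], at the other end of the cycle edge. *)
Lemma rot_inv_tree x p : x \in c -> adj H (nx x) p -> rot (nx x) p = x -> adj T (nx x) p.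
Proof.
move=> xc np rp; have nc : nx x \in c by rewrite mem_next.
move: (np); rewrite halin_adjE => /orP[//|].
rewrite adj_cycle // nc => /orP[/eqP e|/andP[pc /eqP/(next_inj uniq_c) e]].
  by have := rot_not_involutive np; rewrite rp rot_outer // e eqxx.
by have := rot_neq np; rewrite rp e eqxx.
Qed.

(** ** The facial permutation *)

Let g := face_step rot.

Lemma face_step_inj : injective g.
Proof. by move=> [a b] [a' b'] [/= <- /perm_inj <-]. Qed.

Lemma face_step_dart (d : V * V) : adj H d.1 d.2 -> adj H (g d).1 (g d).2.
Proof. by rewrite adj_sym => /rot_adj. Qed.

Lemma iter_face_dart i (d : V * V) : adj H d.1 d.2 -> adj H (iter i g d).1 (iter i g d).2.
Proof. by move=> dH; elim: i => //= i /face_step_dart. Qed.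

Definition fwd_dart x := (x, nx x).
Definition rev_dart x := (nx x, x).

(** Otherwise the face is traced by a walk in the tree that never turns back. *)
Lemma face_meets_cycle (d : V * V) : adj H d.1 d.2 ->
  exists2 x, x \in c & fconnect g d (fwd_dart x) || fconnect g d (rev_dart x).
Proof.
move=> dH; apply: contrapT => nocyc.
pose v i := (iter i g d).1.
have v1 i : v i.+1 = (iter i g d).2 by [].
have v2 i : v i.+2 = rot (v i.+1) (v i) by [].
have Hv i : adj H (v i) (v i.+1) by apply: iter_face_dart.
have Tv i : adj T (v i) (v i.+1).
  have := Hv i; rewrite halin_adjE => /orP[//|].
  rewrite adj_cycle // => /orP[]/andP[xc /eqP e].
    case: nocyc; exists (v i); rewrite // /fwd_dart /nx -e v1 -surjective_pairing.
    by rewrite fconnect_iter.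
  case: nocyc; exists (v i.+1); rewrite // /rev_dart /nx -e v1 -surjective_pairing.
  by rewrite fconnect_iter orbT.
have [i e] := tree_backtrack treeT Tv.
have := @rot_neq (v i.+1) (v i); rewrite -v2 e eqxx adj_sym => /(_ (Hv i)).
by [].
Qed.

(** The forward darts form the outer face. *)
Lemma fconnect_fwd x d : x \in c -> fconnect g (fwd_dart x) d ->
  exists2 z, z \in c & d = fwd_dart z.
Proof.
move=> xc /iter_findex <-; elim: (findex _ _ _) => [|i [z zc /= ->]].
  by exists x.
exists (nx z); first by rewrite mem_next.
by rewrite /g /face_step /fwd_dart /= rot_outer.
Qed.

Lemma rev_neq_fwd x z : z \in c -> rev_dart x <> fwd_dart z.
Proof.
move=> zc [xz zx]; have := next2_neq uniq_c size_c zc.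
by rewrite -[next c z]/(nx z) -zx -[next c x]/(nx x) xz eqxx.
Qed.

Lemma fconnect_fwd_fwd x y : x \in c -> y \in c -> fconnect g (fwd_dart x) (fwd_dart y).
Proof.
move=> xc yc.
by rewrite (@fconnect_cycle _ g (map fwd_dart c)) ?map_f //; apply: outer.
Qed.

(** Every inner face has a backward dart, by [face_meets_cycle]; these darts
    reduce the count of faces to the question which of them share a face. *)
Lemma nb_facesE :
  nb_faces H rot = #|[set froot g (rev_dart x) | x in c]|.+1.
Proof.
have sym := fconnect_sym face_step_inj.
have [x0 x0c] : exists x, x \in c.
  by case: (c) size_c => // x s _; exists x; rewrite inE eqxx.
have notin : froot g (fwd_dart x0) \notin [set froot g (rev_dart x) | x in c].
  apply/imsetP => [[x xc /eqP]]; rewrite root_connect // => /(fconnect_fwd x0c)[z zc].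
  exact: rev_neq_fwd.
rewrite -add1n -[1]/(nat_of_bool true) -notin -cardsU1 /nb_faces /n_comp_mem.
apply: eq_card => d; rewrite !inE -/g; apply/andP/orP => [[/eqP rd dH]|].
  have [x xc /orP[]] := face_meets_cycle dH => dx; [left|right]; last first.
    by apply/imsetP; exists x => //; rewrite -rd; apply/rootP.
  rewrite -rd -/g root_connect // (connect_trans dx) //.
  exact: fconnect_fwd_fwd.
have rootdart d' : adj H d'.1 d'.2 -> froots g (froot g d') && adj H (froot g d').1 (froot g d').2.
  move=> d'H; rewrite roots_root //=.
  by rewrite -(iter_findex (connect_root _ d')) iter_face_dart.
case=> [/eqP->|/imsetP[x xc ->]]; apply/andP/rootdart; first exact: adj_next.
by rewrite adj_sym; apply: adj_next.
Qed.

Lemma card_halin : #|H| = #|T| + size c.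
Proof.
rewrite cardsU (card_cycle_edges uniq_c size_c).
by rewrite (_ : T :&: _ = set0) ?cards0 ?subn0 //; apply/eqP; rewrite setI_eq0.
Qed.

Lemma nb_faces_max :
    {in c &, forall x y, fconnect g (rev_dart x) (rev_dart y) -> x = y} ->
  nb_faces H rot = (size c).+1.
Proof.
move=> inj; rewrite nb_facesE card_in_imset ?(card_uniqP uniq_c) // => x y xc yc /eqP.
by rewrite root_connect; [apply: inj | apply: fconnect_sym face_step_inj].
Qed.

Section Plane.
Hypotheses (euler : #|V| + nb_faces H rot = #|H| + 2).
Hypotheses (C4free : free_of (cycle_graph 4) H).

(** The backward darts bound the number of inner faces by [size c], and
    connectedness bounds [#|T|] from below; Euler's formula makes both bounds
    equalities. *)
Lemma plane_tree_card : #|T| + 1 = #|V| /\ {in c &, forall x y,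
  fconnect g (rev_dart x) (rev_dart y) -> x = y}.
Proof.
have [sT cT _] := treeT.
have le_A : #|[set froot g (rev_dart x) | x in c]| <= #|c| by apply: leq_imset_card.
have := connected_card sT cT; move: euler; rewrite nb_facesE card_halin.
move: le_A; rewrite (card_uniqP uniq_c) => le_A eul leV; split; first by lia.
have /imset_injP inj : #|[set froot g (rev_dart x) | x in c]| == #|c|.
  by rewrite (card_uniqP uniq_c); apply/eqP; lia.
move=> x y xc yc xy; apply: inj => //; apply/eqP.
by rewrite root_connect //; apply: fconnect_sym face_step_inj.
Qed.

(** The length of the inner face at the cycle edge from [x] to [next c x]. *)
Let flen x := fingraph.order g (rev_dart x).

(** Distinct inner faces use disjoint sets of darts, none of them on the outer
    face. *)
Lemma sum_face_lengths : \sum_(x in c) flen x + size c <= 2 * #|H|.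
Proof.
have [_ inj] := plane_tree_card.
have sym := fconnect_sym face_step_inj.
rewrite -card_darts; last exact: halin_simple.
have <- : #|map fwd_dart c| = size c.
  by rewrite (card_uniqP _) ?size_map // map_inj_uniq // => x y [].
rewrite -[#|map fwd_dart c|]sum1_card -[X in _ <= X]sum1_card big_mkcond /=.
rewrite [X in _ + X]big_mkcond [X in _ <= X]big_mkcond /=.
have -> : \sum_x (if x \in c then flen x else 0) =
          \sum_d \sum_(x in c) (fconnect g (rev_dart x) d : nat).
  rewrite exchange_big [RHS]big_mkcond /=; apply: eq_bigr => x _; case: (x \in c) => //.
  rewrite /flen /fingraph.order -sum1_card big_mkcond /=; apply: eq_bigr => d _.
  by rewrite -[d \in _]/(connect (frel g) (rev_dart x) d); case: connect.
rewrite -big_split /=; apply: leq_sum => d _.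
have [/mapP[z zc ->]|_] := boolP (d \in map fwd_dart c).
  rewrite big1 ?add0n; last first.
    move=> x xc; apply/eqP; rewrite eqb0; apply/negP; rewrite sym => /(fconnect_fwd zc)[w wc].
    exact: rev_neq_fwd.
  by rewrite inE adj_next.
rewrite addn0.
have [[x xc xd]|no] := pselect (exists2 x, x \in c & fconnect g (rev_dart x) d).
  rewrite (bigD1 x) //= xd big1 ?addn0; last first.
    move=> y /andP[yc nyx]; apply/eqP; rewrite eqb0; apply: contra nyx => yd.
    by apply/eqP/inj => //; rewrite (connect_trans yd) // sym.
  rewrite -(iter_findex xd) inE iter_face_dart //.
  by rewrite adj_sym adj_next.
by rewrite big1 // => x xc; apply/eqP; rewrite eqb0; apply/negP => xd; apply: no; exists x.
Qed.

(** As the facial walk never turns back, a face of length 4 is a four-cycle. *)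
Lemma face_length x : x \in c -> flen x = 3 \/ 5 <= flen x.
Proof.
move=> xc; have sH := halin_simple; have xn := adj_next xc.
have := iter_order face_step_inj (rev_dart x); rewrite -/(flen x).
have := fingraph.order_gt0 g (rev_dart x); rewrite -/(flen x).
case: (flen x) => [|[|[|[|[|k]]]]] //= _; [| |by left| |by right].
- by move=> [e _]; have := adj_neq sH xn; rewrite -e eqxx.
- by move=> [e _]; have := rot_neq xn; rewrite e eqxx.
set p := rot x (nx x); set q := rot p x => - [qn _].
have xp : adj H x p := rot_adj xn.
have px : adj H p x by rewrite adj_sym.
have pq : adj H p q := rot_adj px.
have qy : adj H q (nx x) by rewrite -qn; apply: rot_adj; rewrite adj_sym.
case: C4free; apply: (four_cycle_copy sH xp pq qy).
- by rewrite adj_sym.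
- by rewrite eq_sym (rot_neq px).
- exact: rot_neq xn.
Qed.

Lemma triangle_parent x : x \in c -> flen x = 3 ->
  exists2 p, adj T x p & adj T (nx x) p.
Proof.
move=> xc f3; have := iter_order face_step_inj (rev_dart x).
rewrite -/(flen x) f3 => -[pn e]; exists (rot x (nx x)); first exact: rot_next_tree.
have xp := rot_adj (adj_next xc).
apply: rot_inv_tree => //; last by move: e; rewrite pn.
by rewrite adj_sym -{2}pn; apply: rot_adj; rewrite adj_sym.
Qed.

(** Two triangles in a row give three consecutive leaves the same parent [r],
    and [r] closes a four-cycle with them. *)
Lemma adjacent_face_lengths x : x \in c -> 8 <= flen x + flen (nx x).
Proof.
move=> xc; have nc : nx x \in c by rewrite mem_next.
have [f3|] := face_length xc; last by have [] := face_length nc; lia.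
have [f3'|] := face_length nc; last by rewrite f3; lia.
have [p xp np] := triangle_parent xc f3.
have [q nq nnq] := triangle_parent nc f3'.
have [r nr] := leaf_adj_unique nc.
move: np nq; rewrite !nr => /eqP e /eqP e'; rewrite {}e {}e' in xp nnq.
have TH u v : adj T u v -> adj H u v by rewrite halin_adjE => ->.
case: C4free; apply: (@four_cycle_copy _ _ (nx x) (nx (nx x)) r x).
- exact: halin_simple.
- exact: adj_next.
- exact: TH.
- by rewrite adj_sym; apply: TH.
- exact: adj_next.
- by have [sT _ _] := treeT; apply: (@adj_neq _ T) => //; rewrite nr.
- exact: next2_neq.
Qed.

(** Each face length occurs twice in the sum of [flen x + flen (next c x)]
    around the cycle. *)
Lemma plane_C4free_leaves : 3 * size c <= 2 * (#|V| - 1) /\ #|H| = #|V| - 1 + size c.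
Proof.
have [cardT _] := plane_tree_card.
have := sum_face_lengths; rewrite card_halin.
have e : \sum_(x in c) flen (nx x) = \sum_(x in c) flen x.
  rewrite [RHS](reindex_inj (next_inj uniq_c)) /=.
  by apply: eq_bigl => x; rewrite mem_next.
have : \sum_(x in c) 8 <= \sum_(x in c) flen x + \sum_(x in c) flen (nx x).
  by rewrite -big_split; apply: leq_sum => x; apply: adjacent_face_lengths.
by rewrite e sum_nat_const (card_uniqP uniq_c); lia.
Qed.

End Plane.
End Faces.

Lemma halin_C4free_edges n (H : {set {set 'I_n}}) :
  halin H -> free_of (cycle_graph 4) H -> 3 * #|H| <= 5 * (n - 1).
Proof.
move=> [n4 [T [c [[tT dT] [uc sc mc] dis defH [rot [[_ rs eul] out]]]]]] free.
rewrite defH in rs eul free *.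
have [] := plane_C4free_leaves tT dT uc sc mc dis rs out eul free.
by rewrite card_ord; lia.
Qed.

(** * A criterion for the absence of four-cycles *)

Section Criterion.
Variables (V : finType) (T : {set {set V}}) (c : seq V).
Hypotheses (treeT : tree T) (uniq_c : uniq c) (size_c : 4 < size c).
Hypothesis mem_c : c =i leaf T.
Let H := T :|: cycle_edges c.
Let nx := next c.

Hypothesis leaf_nonadj : forall x p, x \in c -> adj T x p -> p \notin c.
Hypothesis parents_nonadj : forall x p q,
  x \in c -> adj T x p -> adj T (nx x) q -> ~ adj T p q.
Hypothesis parents_neq : forall x p, x \in c -> adj T x p -> ~ adj T (nx (nx x)) p.

Let quad x y z t :=
  [/\ adj H x y /\ adj H y z, adj H z t /\ adj H t x & x != z /\ y != t].

Let HE x y : adj H x y = [|| adj T x y, (x \in c) && (y == nx x) | (y \in c) && (x == nx y)].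
Proof. by rewrite /adj inE -adj_cycle // ltnW // ltnW. Qed.

Let HT x y : x \notin c -> adj H x y -> adj T x y.
Proof.
move=> xNc; rewrite HE (negPf xNc) /= => /orP[//|/andP[yc /eqP xy]].
by rewrite xy mem_next yc in xNc.
Qed.

(** A leaf has only one neighbour in the tree, so a path through it that uses
    this neighbour goes on along the cycle. *)
Let HT2 x y p : x \in c -> adj T x p -> y != p -> adj H x y ->
  y \in c /\ (y = nx x \/ x = nx y).
Proof.
move=> xc xp yp; rewrite HE => /or3P[xy|/andP[_ /eqP->]|/andP[yc /eqP->]]; last by auto.
  have [q xE] := leaf_adj_unique treeT mem_c xc.
  by move: xy xp yp; rewrite !xE => /eqP-> /eqP->; rewrite eqxx.
by rewrite mem_next xc; auto.
Qed.

Let quad_rot x y z t : quad x y z t -> quad y z t x.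
Proof. by case=> [[xy yz] [zt tx] [xz yt]]; split=> //; split; rewrite // eq_sym. Qed.

Let quad_rev x y z t : quad x y z t -> quad x t z y.
Proof.
case=> [[xy yz] [zt tx] [xz yt]].
by split; split; rewrite 1?adj_sym // eq_sym.
Qed.

(** A four-cycle through an inner vertex either closes up above two or three
    consecutive leaves or stays in the tree. *)
Let quad_leaf x y z t : quad x y z t -> x \in c.
Proof.
wlog yt : y t / (y \in c) || (t \notin c).
  move=> th q; have [yc|yNc] := boolP (y \in c); first by apply: th q; rewrite yc.
  by apply: th (quad_rev q); rewrite yNc orbT.
case=> [[xy yz] [zt tx] [nxz nyt]]; apply: contraT => xNc.
have Txy := HT xNc xy; have Txt : adj T x t by apply: HT; rewrite // adj_sym.
have Tyx : adj T y x by rewrite adj_sym.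
have Ttx : adj T t x by rewrite adj_sym.
have nzx : z != x by rewrite eq_sym.
have [yc|yNc] := boolP (y \in c); last first.
  have tNc : t \notin c by move: yt; rewrite (negPf yNc).
  have Tyz := HT yNc yz; have Tzt : adj T z t by rewrite adj_sym; apply: HT; rewrite // adj_sym.
  have [sT _ acy] := treeT; case: (acy [:: x; y; z; t]) => //.
  rewrite /ucycle /= Txy Tyz Tzt Ttx /= !inE !negb_or nxz nyt (adj_neq sT Txy).
  by rewrite (adj_neq sT Tyz) (adj_neq sT Tzt) eq_sym (adj_neq sT Ttx).
have [zc yzE] := HT2 yc Tyx nzx yz.
have [tc|tNc] := boolP (t \in c).
  have tz : adj H t z by rewrite adj_sym.
  have [_ tzE] := HT2 tc Ttx nzx tz.
  case: yzE tzE => [zE|yE] [zE'|tE].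
  - by move: nyt; rewrite (next_inj uniq_c (etrans (esym zE) zE')) eqxx.
  - by case: (parents_neq yc Tyx); rewrite -zE -tE.
  - by case: (parents_neq tc Ttx); rewrite -zE' -yE.
  - by rewrite yE tE eqxx in nyt.
have Ttz : adj T t z by apply: HT; rewrite // adj_sym.
have Tzt : adj T z t by rewrite adj_sym.
case: yzE => [zE|yE].
  by case: (parents_nonadj yc Tyx _ Txt); rewrite -zE.
by case: (parents_nonadj zc Tzt _ Ttx); rewrite -yE.
Qed.

(** The cycle is too long to be a four-cycle itself. *)
Let next_order x : x \in c -> nx (nx (nx (nx x))) <> x.
Proof.
move=> xc e4.
have cyc4 : fcycle nx [:: x; nx x; nx (nx x); nx (nx (nx x))].
  by rewrite /= !eqxx e4 eqxx.
have := order_le_cycle cyc4 (mem_head _ _).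
by rewrite (order_cycle (cycle_next uniq_c)) // leqNgt size_c.
Qed.

Let quadF x y z t : ~ quad x y z t.
Proof.
move=> q; have q2 := quad_rot q; have q3 := quad_rot q2; have q4 := quad_rot q3.
have xc := quad_leaf q; have yc := quad_leaf q2; have zc := quad_leaf q3.
have tc := quad_leaf q4.
have cyc u v : u \in c -> v \in c -> adj H u v -> v = nx u \/ u = nx v.
  move=> uc vc; rewrite HE => /or3P[uv|/andP[_ /eqP->]|/andP[_ /eqP->]]; auto.
  by have := leaf_nonadj uc uv; rewrite vc.
wlog yE : x y z t q xc yc zc tc {q2 q3 q4} / y = nx x.
  move=> th; have [[xy _] _ _] := q; have [yE|xE] := cyc _ _ xc yc xy.
    exact: (th _ _ _ _ q).
  exact: (th _ _ _ _ (quad_rev (quad_rot q))).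
have [[xy yz] [zt tx] [nxz nyt]] := q.
have inj := next_inj uniq_c.
have [zE|e] := cyc _ _ yc zc yz; last first.
  by move: nxz; rewrite (inj x z) ?eqxx // -[next c x]/(nx x) -yE.
have [tE|e] := cyc _ _ zc tc zt; last first.
  by move: nyt; rewrite (inj y t) ?eqxx // -[next c y]/(nx y) -zE.
have [xE|e] := cyc _ _ tc xc tx; last first.
  by move: nxz; rewrite (inj z x) ?eqxx // -[next c z]/(nx z) -tE.
by apply: (next_order xc); rewrite -yE -zE -tE -xE.
Qed.

Lemma halin_C4free : free_of (cycle_graph 4) H.
Proof.
move=> [f [inj copy]].
have E (i : 'I_4) : adj H (f i) (f (ordS i)).
  have : f @: [set i; ordS i] \in H by apply/copy/imsetP; exists i.
  by rewrite imsetU1 imset_set1.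
pose i0 : 'I_4 := ord0; pose i1 := ordS i0; pose i2 := ordS i1; pose i3 := ordS i2.
have e4 : ordS i3 = i0 by apply: val_inj.
apply: (@quadF (f i0) (f i1) (f i2) (f i3)).
split; split; rewrite ?E // ?(inj_eq inj) //.
by have := E i3; rewrite e4.
Qed.

End Criterion.

(** * Cyclic orders given by lists *)

Definition cyclic_perm (V : finType) (s : seq V) : {perm V} :=
  perm (can_inj (prev_next (undup_uniq s))).

Lemma cyclic_permE (V : finType) (s : seq V) x : uniq s -> cyclic_perm s x = next s x.
Proof. by move=> us; rewrite permE undup_id. Qed.

Lemma porbit_cyclic_perm (V : finType) (s : seq V) x y :
  uniq s -> x \in s -> (y \in porbit (cyclic_perm s) x) = (y \in s).
Proof.
move=> us xs; have e i : (cyclic_perm s ^+ i)%g x = iter i (next s) x.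
  by rewrite permX; apply: eq_iter => z; apply: cyclic_permE.
rewrite -(fconnect_cycle (cycle_next us) xs); apply/porbitP/idP => [[i ->]|xy].
  by rewrite e fconnect_iter.
by exists (findex (next s) x y); rewrite e iter_findex.
Qed.

Section NextOrdinal.
Variables (n : nat) (Q : pred 'I_n).
Let s := [seq x <- enum 'I_n | Q x].

Lemma sorted_filter_ord : sorted (fun x y : 'I_n => x < y) s.
Proof.
apply: sorted_filter; first by move=> x y z; apply: ltn_trans.
rewrite -[sorted _ _]/(sorted (relpre (val : 'I_n -> nat) ltn) _).
by rewrite -sorted_map val_enum_ord iota_ltn_sorted.
Qed.

Lemma next_filter_spec x : Q x ->
  (x < next s x /\ forall z, Q z -> x < z -> next s x <= z) \/
  (forall z, Q z -> next s x <= z <= x).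
Proof.
move=> Qx; have xs : x \in s by rewrite mem_filter Qx mem_enum.
have ms z : Q z -> z \in s by rewrite mem_filter mem_enum andbT.
have lt_nth y0 i j : i < j -> j < size s -> nth y0 s i < nth y0 s j.
  move=> ij js; have tr : transitive (fun x y : 'I_n => x < y).
    by move=> u v w; apply: ltn_trans.
  by apply: (sorted_ltn_nth tr y0 sorted_filter_ord) => //; rewrite inE (ltn_trans ij).
have nextE : next s x = nth (head x s) s (index x s).+1.
  by rewrite next_nth xs; case: (s) xs.
move: nextE; set y0 := head x s => ->.
have le_nth i j : i <= j -> j < size s -> nth y0 s i <= nth y0 s j.
  rewrite leq_eqVlt => /predU1P[->//|ij js]; apply: ltnW.
  exact: lt_nth.
have lt_x : index x s < size s by rewrite index_mem ms.
have nthx : nth y0 s (index x s) = x by rewrite nth_index ?ms.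
have [lt1|ge1] := ltnP (index x s).+1 (size s).
  left; split; first by rewrite -{1}nthx; apply: lt_nth.
  move=> z Qz; have iz : index z s < size s by rewrite index_mem ms.
  have nthz : nth y0 s (index z s) = z by rewrite nth_index ?ms.
  move=> xz; rewrite -nthz; apply: (le_nth) => //; rewrite ltnNge; apply/negP => le.
  by have := le_nth _ _ le lt_x; rewrite nthx nthz leqNgt xz.
right=> z Qz; have iz : index z s < size s by rewrite index_mem ms.
have nthz : nth y0 s (index z s) = z by rewrite nth_index ?ms.
have -> : nth y0 s (index x s).+1 = nth y0 s 0 by rewrite nth_default // nth0 /y0; case: (s) xs.
rewrite -{1 2}nthz -{1}nthx.
by rewrite !le_nth //; lia.
Qed.

Lemma next_filter_lt x y : Q x -> Q y -> x < y ->
  (forall z, Q z -> x < z -> y <= z) -> next s x = y.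
Proof.
move=> Qx Qy xy ymin; have Qn : Q (next s x).
  have : next s x \in s by rewrite mem_next mem_filter Qx mem_enum.
  by rewrite mem_filter => /andP[].
apply/val_inj/eqP; rewrite eqn_leq; case: (next_filter_spec Qx) => [[lt1 min]|all].
  by rewrite min //= ymin.
by have := all _ Qy; rewrite [y <= x]leqNgt xy andbF.
Qed.

Lemma next_filter_wrap x y : Q x -> Q y ->
  (forall z, Q z -> y <= z <= x) -> next s x = y.
Proof.
move=> Qx Qy ext; have Qn : Q (next s x).
  have : next s x \in s by rewrite mem_next mem_filter Qx mem_enum.
  by rewrite mem_filter => /andP[].
apply/val_inj/eqP; rewrite eqn_leq; have /andP[yn nx] := ext _ Qn; rewrite /= yn andbT.
case: (next_filter_spec Qx) => [[lt1 min]|all]; first by rewrite ltnNge nx in lt1.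
by have /andP[] := all _ Qy.
Qed.

End NextOrdinal.

(** * Plane trees in preorder *)

(** A rooted plane tree on the vertices [0], ..., [n], numbered in preorder, is
    given by its parent function.  A numbering with [par v < v] is a preorder
    when the arcs from the vertices to their parents, drawn above a horizontal
    line, do not cross.  The hypothesis [branching] gives every inner vertex degree
    at least 3: the first child of an inner vertex [v] is [v.+1], and the root [0]
    needs two further children because it has no parent. *)
Section Preorder.
Variables (n : nat) (par : nat -> nat).
Hypothesis n_gt0 : 0 < n.
Hypothesis par0 : par 0 = 0.
Hypothesis par_lt : forall v, 0 < v -> v <= n -> par v < v.
Hypothesis noncrossing : forall u v, par v < u -> u < v -> v <= n -> par v <= par u.
Hypothesis branching : forall v, v < n -> par v.+1 = v -> exists2 u,
  v.+1 < u <= n /\ par u = v & v = 0 -> exists2 w, u < w <= n & par w = 0.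

Let V := 'I_n.+1.
Implicit Types u v w x y : V.

Definition parent v : V := inord (par v).
Definition preorder_tree : {set {set V}} := [set [set v; parent v] | v in [set~ ord0]].
Definition childless : pred V := fun v => [forall w, (w != ord0) ==> (parent w != v)].
Definition preorder_leaves : seq V := [seq v <- enum 'I_n.+1 | childless v].

Let T := preorder_tree.
Let c := preorder_leaves.
Let H := T :|: cycle_edges c.

Let ord_neq0 v : (v != ord0) = (0 < v).
Proof. by rewrite -val_eqE lt0n. Qed.

Let ord_le v : v <= n.
Proof. by rewrite -ltnS. Qed.

Lemma parentE v : parent v = par v :> nat.
Proof.
rewrite inordK //; have [->|v0] := posnP v; first by rewrite par0.
by rewrite ltnS (leq_trans (ltnW (par_lt v0 (ord_le v)))) // ord_le.
Qed.

Let ord_of m (mn : m <= n) : {v : V | v = m :> nat}.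
Proof. by exists (inord m); rewrite inordK. Qed.

Lemma parent_lt v : 0 < v -> parent v < v.
Proof. by move=> v0; rewrite parentE par_lt ?ord_le. Qed.

Lemma preorder_adj x y :
  adj T x y = (0 < x) && (y == parent x) || (0 < y) && (x == parent y).
Proof.
apply/imsetP/orP => [[v]|].
  rewrite !inE ord_neq0 => v0 e.
  have: x \in [set v; parent v] by rewrite -e !inE eqxx.
  have: y \in [set v; parent v] by rewrite -e !inE eqxx orbT.
  have: v \in [set x; y] by rewrite e !inE eqxx.
  have: parent v \in [set x; y] by rewrite e !inE eqxx orbT.
  have nv : parent v != v by rewrite -val_eqE neq_ltn parent_lt.
  rewrite !inE => pE vE /orP[]/eqP yE /orP[]/eqP xE; subst x y.
  - by move: pE; rewrite orbb (negPf nv).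
  - by right; rewrite v0 eqxx.
  - by left; rewrite v0 eqxx.
  - by move: vE; rewrite orbb eq_sym (negPf nv).
case=> /andP[v0 /eqP->]; first by exists x; rewrite // !inE ord_neq0.
by exists y; rewrite ?inE ?ord_neq0 // setUC.
Qed.

Lemma preorder_simple : simple_graph T.
Proof.
move=> A /imsetP[v]; rewrite !inE ord_neq0 => v0 ->.
by rewrite cards2 -val_eqE neq_ltn parent_lt ?orbT.
Qed.

Lemma card_preorder_tree : #|T| = n.
Proof.
rewrite card_in_imset; last first.
  move=> u v; rewrite !inE !ord_neq0 => u0 v0 e.
  have: u \in [set v; parent v] by rewrite -e !inE eqxx.
  have: v \in [set u; parent u] by rewrite e !inE eqxx.
  rewrite !inE => /orP[/eqP //|/eqP vE] /orP[/eqP //|/eqP uE].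
  have := parent_lt u0; rewrite -vE; have := parent_lt v0; rewrite -uE.
  by move=> /ltnW; rewrite leqNgt => /negPf->.
by rewrite cardsC1 card_ord.
Qed.

(** In a cycle the largest vertex would have its parent as both neighbours. *)
Lemma preorder_is_tree : tree T.
Proof.
split; first exact: preorder_simple.
  split=> [|x y]; first by rewrite card_ord.
  have sym : connect_sym (adj T) by apply: sym_connect_sym; apply: adj_sym.
  suff to0 z : connect (adj T) z ord0 by rewrite (connect_trans (to0 x)) // sym.
  have [m] := ubnP z; elim: m z => // m IH z; rewrite ltnS => zm.
  have [z0|z0] := posnP z; first by rewrite (_ : z = ord0) //; apply: val_inj.
  apply: connect_trans (connect1 (_ : adj T z (parent z))) (IH _ _).
    by rewrite preorder_adj z0 eqxx.
  exact: leq_trans (parent_lt z0) zm.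
move=> s s2 /andP[cyc us].
have [i0 i0s] : exists i, i \in s by case: (s) s2 => // a s' _; exists a; rewrite inE eqxx.
case: (arg_maxnP (fun i : V => val i) i0s) => m ms mmax.
have up y : y \in s -> adj T m y -> y = parent m.
  move=> ys; have le : y <= m := mmax _ ys.
  rewrite preorder_adj => /orP[]/andP[y0 /eqP //].
  by move=> mE; have := parent_lt y0; rewrite -mE ltnNge le.
have := next_neq_prev us s2 ms.
rewrite (up (next s m)) ?mem_next ?next_cycle // (up (prev s m)) ?mem_prev ?eqxx //.
by rewrite adj_sym prev_cycle.
Qed.

Lemma childlessPn v : reflect (exists w, 0 < w /\ parent w = v) (~~ childless v).
Proof.
apply: (iffP forallPn) => [[w]|[w [w0 e]]].
  by rewrite negb_imply negbK ord_neq0 => /andP[w0 /eqP e]; exists w.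
by exists w; rewrite negb_imply negbK ord_neq0 w0 e eqxx.
Qed.

Lemma first_child v : ~~ childless v -> v < n /\ par v.+1 = v.
Proof.
move=> /childlessPn[w [w0 e]]; have vw : v < w by rewrite -e parent_lt.
have vn : v < n by apply: leq_trans vw (ord_le w).
have pw : par w = v by rewrite -e parentE.
split=> //; move: vw; rewrite leq_eqVlt => /predU1P[->//|vw].
have := @noncrossing v.+1 w; rewrite pw leqnn => /(_ isT vw (ord_le w)).
by have := par_lt (ltn0Sn v) vn; lia.
Qed.

Lemma parent_not_childless v : 0 < v -> ~~ childless (parent v).
Proof. by move=> v0; apply/childlessPn; exists v. Qed.

Lemma childless_gt0 v : childless v -> 0 < v.
Proof.
move=> ch; rewrite -ord_neq0; apply: contraL ch => /eqP->.
have [w w1] := ord_of n_gt0; have w0 : 0 < w by rewrite w1.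
apply/childlessPn; exists w; split=> //; apply/val_inj/eqP.
by have := parent_lt w0; rewrite w1 ltnS leqn0.
Qed.

Lemma preorder_degree v : ~~ childless v -> 3 <= degree T v.
Proof.
move=> /first_child[vn p1]; rewrite degree_card_adj; last exact: preorder_simple.
have [u [/andP[u1 un] pu] third] := branching vn p1.
have [a aE] := ord_of vn; have [b bE] := ord_of un.
have child x y : 0 < y -> par y = x -> adj T x y.
  by move=> y0 pE; rewrite preorder_adj y0 orbC -val_eqE /= parentE pE eqxx.
have three x y z : adj T v x -> adj T v y -> adj T v z -> x < y -> y < z ->
    2 < #|[set y | adj T v y]|.
  move=> vx vy vz xy yz; apply: (@leq_trans #|[set x; y; z]|).
    rewrite setUC cardsU1 cards2 !inE !negb_or -!val_eqE /= !neq_ltn.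
    by rewrite xy yz (ltn_trans xy yz) !orbT.
  by apply/subset_leq_card/subsetP => t; rewrite !inE => /orP[/orP[]|]/eqP->.
have va : adj T v a by apply: child; rewrite aE.
have vb : adj T v b by apply: child; rewrite bE //; apply: leq_trans u1.
have [v0|v0] := posnP v.
  have [w /andP[uw wn] pw] := third v0; have [d dE] := ord_of wn.
  have vd : adj T v d by apply: child; rewrite dE ?pw // (leq_trans _ uw).
  by apply: (three a b d); rewrite // ?aE ?bE ?dE.
apply: (three (parent v) a b); rewrite // ?aE ?bE //; last by rewrite ltnS ltnW // parent_lt.
by rewrite preorder_adj v0 eqxx.
Qed.

Lemma preorder_leaf : leaf T =1 childless.
Proof.
move=> v; have [ch|nch] := boolP (childless v); last first.
  by have := preorder_degree nch; rewrite /leaf; case: degree => [|[]].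
rewrite /leaf degree_card_adj; last exact: preorder_simple.
rewrite (_ : [set y | _] = [set parent v]) ?cards1 //; apply/setP => y.
rewrite !inE preorder_adj (childless_gt0 ch) /=.
apply/orP/idP => [[//|/andP[y0 /eqP e]]|]; last by left.
by have := parent_not_childless y0; rewrite -e ch.
Qed.

Let mem_childless v : (v \in c) = childless v.
Proof. by rewrite mem_filter mem_enum andbT. Qed.

Lemma mem_preorder_leaves : c =i leaf T.
Proof. by move=> v; rewrite mem_childless -[RHS]/(leaf T v) preorder_leaf. Qed.

Let uniq_c : uniq c.
Proof. by rewrite filter_uniq ?enum_uniq. Qed.

Hypothesis size_c : 4 < size c.

Let size_c3 : 2 < size c.
Proof. exact: ltnW (ltnW size_c). Qed.

Lemma preorder_disjoint : [disjoint T & cycle_edges c].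
Proof.
rewrite disjoint_subset; apply/subsetP => A /imsetP[v].
rewrite !inE ord_neq0 => v0 ->; apply: contra (parent_not_childless v0) => /imsetP[x xc e].
have: parent v \in [set x; next c x] by rewrite -e !inE eqxx orbT.
by rewrite -mem_childless !inE => /orP[]/eqP->; rewrite ?mem_next.
Qed.

(** ** The planar rotation *)

Let nx := next c.
Let pv := prev c.

(** Around an inner vertex the parent comes first and the children follow from
    left to right, which is the increasing order of the numbers. *)
Definition preorder_nbrs v : seq V :=
  if childless v then [:: parent v; pv v; nx v] else [seq u <- enum 'I_n.+1 | adj T v u].

Definition preorder_rot v : {perm V} := cyclic_perm (preorder_nbrs v).
Let rot := preorder_rot.

Let leaf_parent v : childless v -> [/\ parent v != pv v, parent v != nx v & pv v != nx v].
Proof.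
move=> ch; have vc : v \in c by rewrite mem_childless.
have pc : parent v \notin c.
  by have := parent_not_childless (childless_gt0 ch); rewrite mem_childless.
split; last by rewrite eq_sym next_neq_prev.
  by apply: contraNneq pc => ->; rewrite mem_prev.
by apply: contraNneq pc => ->; rewrite mem_next.
Qed.

Lemma preorder_nbrs_uniq v : uniq (preorder_nbrs v).
Proof.
rewrite /preorder_nbrs; case: ifP => [/leaf_parent[/negPf e1 /negPf e2 /negPf e3]|_].
  by rewrite /= !inE e1 e2 e3.
by rewrite filter_uniq ?enum_uniq.
Qed.

Lemma mem_preorder_nbrs x y : (y \in preorder_nbrs x) = adj H x y.
Proof.
rewrite /adj inE -!/(adj _ _ _) adj_cycle //.
have cE := mem_childless.
rewrite /preorder_nbrs; case: ifP => [ch|nch]; last first.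
  rewrite mem_filter mem_enum andbT !cE nch /=.
  have [yc|_] := boolP (childless y); last by rewrite orbF.
  rewrite /= (_ : x == next c y = false) ?orbF //; apply/negbTE.
  by apply: contraFneq nch => ->; rewrite -cE mem_next cE.
rewrite !inE !cE ch preorder_adj (childless_gt0 ch) /=.
have -> : (0 < y) && (x == parent y) = false.
  by apply/negbTE/andP => [[y0 /eqP e]]; have := parent_not_childless y0; rewrite -e ch.
rewrite orbF; congr (_ || _); rewrite orbC; congr (_ || _).
apply/eqP/andP => [->|[yc /eqP->]]; last by rewrite /pv prev_next.
by rewrite -cE mem_prev cE ch /pv next_prev.
Qed.

Lemma preorder_rotation : rotation_system H rot.
Proof.
move=> x y; rewrite -mem_preorder_nbrs => xy; apply/setP => z.
rewrite porbit_cyclic_perm ?preorder_nbrs_uniq // inE.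
exact: mem_preorder_nbrs.
Qed.

Let rot_leaf v : childless v ->
  [/\ rot v (parent v) = pv v, rot v (pv v) = nx v & rot v (nx v) = parent v].
Proof.
move=> ch; have [/negPf e1 /negPf e2 /negPf e3] := leaf_parent ch.
rewrite /rot /preorder_rot !cyclic_permE ?preorder_nbrs_uniq // /preorder_nbrs ch /=.
by rewrite !eqxx [pv v == _]eq_sym e1 [nx v == parent v]eq_sym e2 [nx v == pv v]eq_sym e3.
Qed.

Let rot_inner v x : ~~ childless v -> rot v x = next [seq u <- enum 'I_n.+1 | adj T v u] x.
Proof.
move=> /negPf ch; rewrite /rot /preorder_rot cyclic_permE ?preorder_nbrs_uniq //.
by rewrite /preorder_nbrs ch.
Qed.

Lemma preorder_outer : bounds_face rot c.
Proof.
rewrite /bounds_face cycle_map; apply: cycle_from_next => // x xc /=.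
rewrite /face_step /=; have ch : childless (nx x) by rewrite -mem_childless mem_next.
have [_ e _] := rot_leaf ch.
by move: e; rewrite /pv /nx prev_next // => ->.
Qed.

(** ** Labels of the faces *)

Definition leaves_before w : nat := #|[pred u | childless u && (u < w)]|.

(** The second condition says that [u] precedes the first vertex after [w] that
    is not a descendant of [w]. *)
Definition leaves_through w : nat :=
  #|[pred u | childless u && [forall t : V, (w < t <= u) ==> (w <= par t)]]|.

Let g := face_step rot.

(** A dart of the tree has the inner face on one side: going down to [w] it is
    the face just before the subtree of [w], going up from [w] the face just
    after it.  Faces are numbered by the leaves that precede them, modulo the
    number of leaves because the face after the last leaf is the one before the
    first leaf.  The forward darts get no label. *)
Inductive face_label : V * V -> nat -> Prop :=
| Label_down w of 0 < w : face_label (parent w, w) (leaves_before w %% size c)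
| Label_up w of 0 < w : face_label (w, parent w) (leaves_through w %% size c)
| Label_rev x of childless x : face_label (nx x, x) ((leaves_before x).+1 %% size c).

Let card_childless : #|[pred u | childless u]| = size c.
Proof. by rewrite -(card_uniqP uniq_c); apply: eq_card => u; rewrite mem_childless. Qed.

Lemma leaves_before_next x : childless x ->
  leaves_before (nx x) = (leaves_before x).+1 %[mod size c].
Proof.
move=> ch; have chn : childless (nx x) by rewrite -mem_childless mem_next mem_childless.
case: (next_filter_spec ch) => [[lt1 min]|ext].
  congr (_ %% _); rewrite /leaves_before.
  rewrite [LHS](cardD1 x) !inE ch lt1 /= add1n; congr _.+1; apply: eq_card => u.
  rewrite !inE -val_eqE /=; have [chu|] := boolP (childless u); last by rewrite !andbF.
  have [ux|xu|//] := ltngtP u x; first by rewrite (ltn_trans ux lt1).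
  by rewrite /= ltnNge [_ <= u](min u chu xu).
rewrite (_ : leaves_before (nx x) = 0); last first.
  apply: eq_card0 => u; rewrite !inE; apply/andP => [[chu]].
  by rewrite ltnNge; have /andP[->] := ext u chu.
rewrite (_ : (leaves_before x).+1 = size c) ?modnn ?mod0n //.
rewrite -card_childless [RHS](cardD1 x) !inE ch add1n; congr _.+1.
apply: eq_card => u; rewrite !inE -val_eqE /= andbC.
have [chu|nchu] := boolP (childless u); last by rewrite !andbF.
by have /andP[_ ux] := ext u chu; rewrite /= ltn_neqAle [u <= x]ux !andbT.
Qed.

Lemma leaves_before_inj : {in childless &, injective leaves_before}.
Proof.
move=> x y; wlog xy : x y / x < y.
  move=> th chx chy e; case: (ltngtP x y) => [lt|lt|/val_inj//]; first exact: th.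
  by apply/esym/th.
move=> chx _ e; have : leaves_before x < leaves_before y; last by rewrite e ltnn.
apply: proper_card; apply/properP; split.
  apply/subsetP => u; rewrite !inE => /andP[-> ux]; exact: ltn_trans xy.
by exists x; rewrite !inE ?ltnn ?andbF // xy andbT.
Qed.

Lemma leaves_before_lt x : childless x -> leaves_before x < size c.
Proof.
move=> chx; rewrite -card_childless; apply: proper_card; apply/properP; split.
  by apply/subsetP => u; rewrite !inE => /andP[].
by exists x; rewrite // !inE ltnn andbF.
Qed.

Lemma leaves_through_leaf w : childless w -> leaves_through w = (leaves_before w).+1.
Proof.
move=> ch; rewrite /leaves_through (cardD1 w) !inE ch /=.
have -> : [forall t : V, (w < t <= w) ==> (w <= par t)].
  by apply/forallP => t; apply/implyP; rewrite andbC ltnNge => /andP[->].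
rewrite add1n; congr _.+1; apply: eq_card => u; rewrite !inE -val_eqE /=.
have [chu|] := boolP (childless u); last by rewrite andbF.
have [uw|wu|_] := ltngtP u w => //=.
  apply/forallP => t; apply/implyP => /andP[wt tu].
  by have := ltn_trans (leq_ltn_trans tu uw) wt; rewrite ltnn.
have [t tE] := ord_of (leq_trans wu (ord_le u)).
apply/negbTE/forallP => /(_ t); rewrite tE ltnSn wu /= => le.
have := par_lt (ltn0Sn w) (leq_trans wu (ord_le u)); rewrite ltnS => ge.
have t0 : 0 < t by rewrite tE.
have := parent_not_childless t0; rewrite (_ : parent t = w) ?ch //.
by apply/val_inj/eqP; rewrite /= parentE tE eqn_leq ge le.
Qed.

(** The arc from [t] to its parent cannot cross the arc from [w] to [v]. *)
Let par_between v w (t : V) : par w = v -> v < w -> w < t -> par t < w -> par t <= v.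
Proof.
move=> pw vw wt pt; rewrite leqNgt; apply/negP => vp.
have := noncrossing pt wt (ord_le t).
by rewrite pw leqNgt vp.
Qed.

Lemma leaves_through_sibling v w w' : 0 < w -> parent w = v ->
    0 < w' -> parent w' = v -> w < w' ->
    (forall t : V, parent t = v -> w < t -> w' <= t) ->
  leaves_through w = leaves_before w'.
Proof.
move=> w0 pw w'0 pw' ww' min; apply: eq_card => u; rewrite !inE; congr (_ && _).
have vw : v < w by rewrite -pw parent_lt.
have pwE : par w = v by rewrite -pw parentE.
have pwE' : par w' = v by rewrite -pw' parentE.
apply/forallP/idP => [/(_ w')|uw' t].
  by rewrite ww' pwE' [w <= v]leqNgt vw implybF -ltnNge.
apply/implyP => /andP[wt tu]; rewrite leqNgt; apply/negP => ptw.
have tw' : t < w' by apply: leq_ltn_trans uw'.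
have le := par_between pwE vw wt ptw.
have vt : v < t by apply: ltn_trans wt.
have := @noncrossing t w'; rewrite pwE' => /(_ vt tw' (ord_le _)) ge.
have: w' <= t; last by rewrite leqNgt tw'.
apply: min wt.
by apply/val_inj/eqP; rewrite /= parentE eqn_leq le ge.
Qed.

Lemma leaves_through_last v w : 0 < w -> parent w = v -> 0 < v ->
    (forall t : V, parent t = v -> t <= w) ->
  leaves_through w = leaves_through v.
Proof.
move=> w0 pw v0 max; apply: eq_card => u; rewrite !inE; congr (_ && _).
have vw : v < w by rewrite -pw parent_lt.
have pwE : par w = v by rewrite -pw parentE.
apply/forallP/forallP => all t; apply/implyP => /andP[lt tu].
  have [tw|wt|->] := ltngtP t w; last by rewrite pwE.
    by have := @noncrossing t w; rewrite pwE; apply.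
  by have := all t; rewrite wt tu /=; apply: leq_trans; apply: ltnW.
have := all t; rewrite (ltn_trans vw lt) tu /= => ge; rewrite leqNgt; apply/negP => ptw.
have le := par_between pwE vw lt ptw.
have: t <= w; last by rewrite leqNgt lt.
apply: max.
by apply/val_inj/eqP; rewrite /= parentE eqn_leq le ge.
Qed.

Lemma leaves_through_root w : 0 < w -> parent w = ord0 ->
    (forall t : V, 0 < t -> parent t = ord0 -> t <= w) ->
  leaves_through w = size c.
Proof.
move=> w0 pw max; rewrite -card_childless; apply: eq_card => u.
rewrite !inE andbC; case: forallP => // [[t]].
apply/implyP => /andP[wt _]; rewrite leqNgt; apply/negP => ptw.
have pwE : par w = 0 by rewrite -parentE pw.
have le := @par_between ord0 w t pwE w0 wt ptw.
have: t <= w; last by rewrite leqNgt wt.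
apply: max (ltn_trans w0 wt) _.
by apply/val_inj/eqP; rewrite /= parentE -leqn0.
Qed.

(** Going down to an inner vertex continues to its first child, and no leaf lies
    between them; going down to a leaf continues to the previous leaf.  Going up
    continues to the next sibling, if there is one, otherwise up again, and from
    the last child of the root down to its first child.  These cases are the
    lemmas above. *)
Lemma face_label_step d k : face_label d k -> face_label (g d) k.
Proof.
have child v w : (0 < w) && (v == parent w) -> v < w.
  by case/andP=> w0 /eqP->; apply: parent_lt.
case=> {d k} [w w0|w w0|x ch]; rewrite /g /face_step /=.
- have [ch|nch] := boolP (childless w).
    have [-> _ _] := rot_leaf ch.
    have wE : w = nx (pv w) by rewrite /nx /pv next_prev.
    have chp : childless (pv w) by rewrite -mem_childless mem_prev mem_childless.
    have -> : leaves_before w %% size c = (leaves_before (pv w)).+1 %% size c.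
      by rewrite {1}wE leaves_before_next.
    by rewrite {1}wE; apply: Label_rev.
  have [wn pw1] := first_child nch; have [w1 w1E] := ord_of wn.
  have pE : parent w1 = w by apply/val_inj; rewrite /= parentE w1E.
  have w1_gt0 : 0 < w1 by rewrite w1E.
  have -> : rot w (parent w) = w1.
    rewrite rot_inner //; apply: next_filter_lt.
    - by rewrite preorder_adj w0 eqxx.
    - by rewrite preorder_adj w1_gt0 pE eqxx orbT.
    - by rewrite w1E ltnS ltnW // parent_lt.
    move=> z /[swap] pz; rewrite preorder_adj => /orP[/andP[_ /eqP e]|/child].
      by rewrite e ltnn in pz.
    by rewrite w1E.
  rewrite (_ : leaves_before w = leaves_before w1).
    by rewrite -{1}pE; apply: Label_down.
  apply: eq_card => u; rewrite !inE w1E ltnS [u <= w]leq_eqVlt val_eqE.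
  by have [->|] := eqVneq u w; rewrite ?(negPf nch).
- set v := parent w; have nch : ~~ childless v := parent_not_childless w0.
  have adj_vw : adj T v w by rewrite preorder_adj w0 eqxx orbT.
  rewrite rot_inner //.
  have [[w' /andP[w'0 /eqP pw'] ww']|nosib] :=
      pselect (exists2 w' : V, (0 < w') && (v == parent w') & w < w').
    pose later : pred V := fun t => (v == parent t) && (w < t).
    have ex : later w' by rewrite /later pw' eqxx.
    case: (arg_minnP (fun t : V => val t) ex) => t /andP[/eqP pt wt] tmin.
    have t0 : 0 < t by apply: leq_ltn_trans wt.
    have -> : next [seq u <- enum 'I_n.+1 | adj T v u] w = t.
      apply: next_filter_lt => //; first by rewrite preorder_adj t0 pt eqxx orbT.
      move=> z /[swap] wz; rewrite preorder_adj => /orP[/andP[v0 /eqP zE]|/andP[z0 vz]].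
        have := parent_lt v0; have := parent_lt w0; rewrite -zE -/v => vw zv.
        by have := ltn_trans (ltn_trans zv vw) wz; rewrite ltnn.
      by apply: tmin; rewrite /later vz.
    rewrite (@leaves_through_sibling v w t) //; first by rewrite {1}pt; apply: Label_down.
    by move=> z zE wz; apply: tmin; rewrite /later zE eqxx.
  have wmax (z : V) : 0 < z -> v = parent z -> z <= w.
    move=> z0 vz; rewrite leqNgt; apply/negP => wz; apply: nosib.
    by exists z; rewrite // z0 vz eqxx.
  have [v0|v0] := posnP v; last first.
    have -> : next [seq u <- enum 'I_n.+1 | adj T v u] w = parent v.
      apply: next_filter_wrap => //; first by rewrite preorder_adj v0 eqxx.
      move=> z; rewrite preorder_adj => /orP[/andP[_ /eqP->]|/andP[z0 /eqP vz]].
        by rewrite leqnn; apply/ltnW/(ltn_trans (parent_lt v0))/parent_lt.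
      by rewrite wmax // andbT; apply/ltnW/(ltn_trans (parent_lt v0)); rewrite vz parent_lt.
    rewrite (@leaves_through_last v w) //; first exact: Label_up.
    move=> t tE; have [t0|t0] := posnP t; first by rewrite t0.
    exact: wmax.
  have vE : v = ord0 by apply: val_inj.
  have [w1 w1E] := ord_of n_gt0; have w1_gt0 : 0 < w1 by rewrite w1E.
  have p1 : parent w1 = ord0.
    by apply/val_inj/eqP; have := parent_lt w1_gt0; rewrite w1E ltnS leqn0.
  have -> : next [seq u <- enum 'I_n.+1 | adj T v u] w = w1.
    apply: next_filter_wrap => //; first by rewrite preorder_adj w1_gt0 p1 vE eqxx orbT.
    move=> z; rewrite preorder_adj v0 /= => /andP[z0 /eqP vz].
    by rewrite w1E z0 wmax.
  rewrite leaves_through_root -?vE //; last by move=> t t0 /esym; apply: wmax.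
  rewrite modnn vE -p1 -(mod0n (size c)) (_ : 0 = leaves_before w1); first exact: Label_down.
  apply/esym/eq_card0 => u; rewrite !inE w1E ltnS leqn0; apply/andP => [[/childless_gt0]].
  by case: (u : nat).
- have [_ _ ->] := rot_leaf ch; rewrite -leaves_through_leaf //.
  exact/Label_up/childless_gt0.
Qed.

Lemma face_label_rev x k : childless x -> face_label (rev_dart c x) k ->
  k = (leaves_before x).+1 %% size c.
Proof.
move=> ch; have chn : childless (nx x) by rewrite -mem_childless mem_next mem_childless.
move e: (rev_dart c x) => d lab; case: lab e => {d k} [w w0|w w0|y _] [e1 e2].
- by have := parent_not_childless w0; rewrite -e1 chn.
- by have := parent_not_childless w0; rewrite -e2 ch.
- by rewrite e2.
Qed.

(** Backward darts at different leaves have different labels, so they lie on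
    different faces. *)
Lemma preorder_faces : nb_faces H rot = (size c).+1.
Proof.
apply: nb_faces_max => //.
- exact: preorder_is_tree.
- by move=> x; rewrite preorder_leaf; apply: preorder_degree.
- exact: mem_preorder_leaves.
- exact: preorder_disjoint.
- exact: preorder_rotation.
- exact: preorder_outer.
move=> x y; rewrite !mem_childless => chx chy /iter_findex e.
have lab i : face_label (iter i g (rev_dart c x)) ((leaves_before x).+1 %% size c).
  by elim: i => [|i IH]; [apply: Label_rev | apply: face_label_step].
move: (lab (findex (face_step rot) (rev_dart c x) (rev_dart c y))).
rewrite e => /face_label_rev-/(_ chy)/eqP.
rewrite -![(leaves_before _).+1]addn1 eqn_modDr !modn_small ?leaves_before_lt // => /eqP.
exact: leaves_before_inj.
Qed.

Lemma preorder_halin : halin H.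
Proof.
split; first by apply: leq_trans (ltnW size_c) _; rewrite -(card_uniqP uniq_c); apply: max_card.
exists T, c; split=> //.
- split; first exact: preorder_is_tree.
  by move=> x; rewrite preorder_leaf; apply: preorder_degree.
- by split=> //; apply: mem_preorder_leaves.
- exact: preorder_disjoint.
exists rot; split; last exact: preorder_outer.
split; last 2 first.
- exact: preorder_rotation.
- rewrite preorder_faces card_halin ?card_preorder_tree ?card_ord //; last first.
    exact: preorder_disjoint.
  by rewrite ?addn2 ?addSn ?addnS.
have [_ [V0 conn] _] := preorder_is_tree; split=> // x y.
by apply: connect_sub (conn x y) => u v uv; apply: connect1; rewrite /adj inE -/(adj T u v) uv.
Qed.

Lemma card_preorder_halin : #|H| = n + size c.
Proof. by rewrite card_halin ?card_preorder_tree //; exact: preorder_disjoint. Qed.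

Lemma preorder_C4free :
    (forall x, childless x ->
       [/\ par (par x) != par (nx x), par (par (nx x)) != par x & par (nx (nx x)) != par x]) ->
  free_of (cycle_graph 4) H.
Proof.
move=> sep; have adjP x p : x \in c -> adj T x p -> p = parent x.
  rewrite mem_childless preorder_adj => ch /orP[/andP[_ /eqP//]|/andP[p0 /eqP e]].
  by have := parent_not_childless p0; rewrite -e ch.
have nxc x : x \in c -> nx x \in c by rewrite mem_next.
apply: halin_C4free => //.
- exact: preorder_is_tree.
- exact: mem_preorder_leaves.
- move=> x p xc /(adjP _ _ xc)->; rewrite mem_childless parent_not_childless //.
  by apply: childless_gt0; rewrite -mem_childless.
- move=> x p q xc /(adjP _ _ xc)-> /(adjP _ _ (nxc _ xc))->.
  have [n1 n2 _] := sep _ (etrans (esym (mem_childless x)) xc).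
  rewrite preorder_adj -!val_eqE /= !parentE.
  by rewrite eq_sym (negPf n1) [_ == par (par _)]eq_sym (negPf n2) !andbF.
move=> x p xc /(adjP _ _ xc)-> /(adjP _ _ (nxc _ (nxc _ xc)))/eqP.
have [_ _ n3] := sep _ (etrans (esym (mem_childless x)) xc).
by rewrite -val_eqE /= !parentE eq_sym (negPf n3).
Qed.

End Preorder.

(** * Extremal trees *)

(** The preorder codes below consist of a fixed prefix [pre], whose root [0] is
    the hub, followed by [m] blocks of three vertices: a child of the hub and its
    two leaves. *)

Section Extremal.
Variables (pre : seq nat) (m : nat).

Definition cherry_par v : nat :=
  if v < size pre then nth 0 pre v
  else if (v - size pre) %% 3 == 0 then 0 else v - (v - size pre) %% 3.

Definition leaf_code v : bool := cherry_par v.+1 != v.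

(** The leaf after the leaf [v]: in the trees at hand at most two inner vertices
    come between consecutive leaves. *)
Definition next_leaf v : nat :=
  if leaf_code v.+1 then v.+1 else if leaf_code v.+2 then v.+2 else v.+3.

(** The hypotheses of [preorder_C4free] for three consecutive leaves. *)
Definition separated v w x : bool :=
  [&& cherry_par (cherry_par v) != cherry_par w,
      cherry_par (cherry_par w) != cherry_par v & cherry_par x != cherry_par v].

(** What has to hold in the prefix: it is a preorder code with enough branching,
    and consecutive leaves that start in it are [separated].  The bounds make
    this decidable by computation; as the blocks all look alike, it does not
    depend on [m]. *)
Definition good_prefix : bool :=
  [&& 1 < size pre, nth 0 pre 0 == 0, nth 0 pre 1 == 0,
      all (fun v => nth 0 pre v < v) (iota 1 (size pre).-1),
      all (fun v => all (fun u => (nth 0 pre v < u) ==> (nth 0 pre v <= nth 0 pre u)) (iota 0 v))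
        (iota 0 (size pre)),
      all (fun v => (cherry_par v.+1 == v) ==>
                    has (fun u => (v.+1 < u) && (cherry_par u == v)) (iota 0 (size pre)))
        (iota 1 (size pre).-1),
      all (fun v => leaf_code v ==>
             leaf_code (next_leaf v) && separated v (next_leaf v) (next_leaf (next_leaf v)))
        (iota 0 (size pre)),
      has leaf_code (iota 0 (size pre))
    & all (fun v => leaf_code v ==> (0 < cherry_par v)) (iota 0 (size pre))].

(* Together with the vertex 1, two blocks give the hub degree at least 3. *)
Hypotheses (good : good_prefix) (m_gt1 : 1 < m).

Let s := size pre.
(* The number of the last vertex. *)
Let n := (s + 3 * m).-1.
Let par := cherry_par.

Let s_gt1 : 1 < s. Proof. by case/and5P: good. Qed.

Let par_tail v : s <= v -> (v - s) %% 3 = 0 /\ par v = 0 \/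
   (0 < (v - s) %% 3 /\ par v = v - (v - s) %% 3).
Proof.
move=> sv; rewrite /par /cherry_par ltnNge sv /=; case: ((v - s) %% 3) => [|r]; auto.
Qed.

Let par_pre v : v < s -> par v = nth 0 pre v.
Proof. by rewrite /par /cherry_par => ->. Qed.

Let in_iota v : v < s -> v \in iota 0 s.
Proof. by rewrite mem_iota. Qed.

Let par0 : par 0 = 0.
Proof. by rewrite par_pre ?(ltnW s_gt1) //; case/and3P: good => _ /eqP. Qed.

Let par_lt v : 0 < v -> v <= n -> par v < v.
Proof.
move=> v0 _; have [vs|sv] := ltnP v s; last by have := par_tail sv; lia.
rewrite par_pre //; case/and5P: good => _ _ _ /allP/(_ v) all _; apply: all.
by rewrite mem_iota; lia.
Qed.

Let noncrossing u v : par v < u -> u < v -> v <= n -> par v <= par u.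
Proof.
move=> pu uv _; have [vs|sv] := ltnP v s; last first.
  have := par_tail sv; have [us|su] := ltnP u s; first by lia.
  by have := par_tail su; lia.
have us := ltn_trans uv vs.
case/and5P: good => _ _ _ _ /and5P[/allP/(_ v (in_iota vs))/allP/(_ u) all _ _ _ _].
by rewrite mem_iota !par_pre // in all pu *; apply: (implyP (all _)).
Qed.

Let leaf_tail v : s <= v -> leaf_code v = ((v - s) %% 3 != 0).
Proof.
move=> sv; rewrite /leaf_code -/par; have [] := par_tail (leqW sv); lia.
Qed.

Let branching v : v < n -> par v.+1 = v -> exists2 u,
  v.+1 < u <= n /\ par u = v & v = 0 -> exists2 w, u < w <= n & par w = 0.
Proof.
move=> vn pv; have [v0|v0] := posnP v.
  have ps : par s = 0 by have := par_tail (leqnn s); lia.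
  have ps3 : par (s + 3) = 0 by have := par_tail (leq_addr 3 s); lia.
  exists s; first by rewrite v0; split; rewrite // /n; lia.
  by move=> _; exists (s + 3) => //; rewrite /n; lia.
have [vs|sv] := ltnP v s; last first.
  have := leaf_tail sv; rewrite /leaf_code -/par pv eqxx => /esym/negbFE/eqP v3.
  have sv2 : s <= v.+2 by lia.
  exists v.+2; last by lia.
  have := par_tail sv2; rewrite /n in vn *; lia.
case/and5P: good => _ _ _ _ /and5P[_ /allP/(_ v) all _ _ _].
have: v \in iota 1 s.-1 by rewrite mem_iota; lia.
move=> /all; rewrite -/par pv eqxx /= => /hasP[u]; rewrite mem_iota -/s => us /andP[vu /eqP pu].
exists u; last by lia.
by rewrite vu /n; split=> //; lia.
Qed.

Lemma leaf_codeE (v : 'I_n.+1) : childless par v = leaf_code v.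
Proof.
have n_gt0 : 0 < n by rewrite /n; lia.
have [ch|nch] := boolP (childless par v); apply/esym.
  apply/eqP => e; have v_n : v < n.
    have := ltn_ord v; rewrite ltnS leq_eqVlt => /predU1P[vn|//].
    have sv : s <= v.+1 by rewrite vn /n; lia.
    have := par_tail sv; rewrite [par _]e vn /n; lia.
  have := @parent_not_childless n par (Ordinal (v_n : v.+1 < n.+1)) isT.
  rewrite (_ : parent _ _ = v) ?ch //; apply: val_inj.
  by rewrite /= parentE //=.
have [vn e] := first_child n_gt0 par0 par_lt noncrossing nch.
by rewrite /leaf_code -/par e eqxx.
Qed.

Lemma size_preorder_leaves : size (preorder_leaves n par) = count leaf_code (iota 0 s) + 2 * m.
Proof.
rewrite /preorder_leaves size_filter (eq_count leaf_codeE).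
rewrite -[count _ _]/(count (preim (val : 'I_n.+1 -> nat) leaf_code) _) -count_map val_enum_ord.
have -> : n.+1 = s + 3 * m by rewrite /n; lia.
elim: (m) => [|k IH]; first by rewrite muln0 !addn0.
rewrite (_ : s + 3 * k.+1 = (s + 3 * k) + 3); last by lia.
rewrite iotaD count_cat IH /= add0n !leaf_tail; lia.
Qed.

Let c := preorder_leaves n par.

Let nE : n.+1 = s + 3 * m. Proof. by rewrite /n; lia. Qed.

Let n_mod : (n - s) %% 3 = 2. Proof. by rewrite /n; lia. Qed.

Let par_le v : par v <= v.
Proof.
have [->|v0] := posnP v; first by rewrite par0.
have [vs|sv] := ltnP v s; last by have := par_tail sv; lia.
by apply/ltnW/par_lt => //; rewrite /n; lia.
Qed.

Let next_leaf_tail v : s <= v -> leaf_code v ->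
  (v - s) %% 3 = 1 /\ next_leaf v = v.+1 \/ (v - s) %% 3 = 2 /\ next_leaf v = v.+2.
Proof.
move=> sv; rewrite /next_leaf !leaf_tail ?(leqW sv) //; last by lia.
by case: ifP => e1 v3; [left|right; case: ifP => e2]; lia.
Qed.

Let prefixP v : v < s -> leaf_code v ->
  [/\ leaf_code (next_leaf v), separated v (next_leaf v) (next_leaf (next_leaf v))
    & 0 < par v].
Proof.
move=> vs lv; case/and5P: good => _ _ _ _.
case/and5P=> _ _ /allP/(_ _ (in_iota vs)) nl _ /allP/(_ _ (in_iota vs)) p0.
by move: nl p0; rewrite lv /= => /andP[-> ->] ->.
Qed.

Let next_leafP v : leaf_code v -> v < n -> leaf_code (next_leaf v) /\ v < next_leaf v <= n.
Proof.
move=> lv vn; have [vs|sv] := ltnP v s.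
  have [-> _ _] := prefixP vs lv; split=> //.
  by rewrite /next_leaf; case: ifP => _; [|case: ifP => _]; rewrite /n; lia.
have [[v3 ->]|[v3 ->]] := next_leaf_tail sv lv; rewrite leaf_tail; lia.
Qed.

Let next_ord (x : 'I_n.+1) : leaf_code x -> x < n -> next c x = next_leaf x :> nat.
Proof.
move=> lx xn; have [ly /andP[xy yn]] := next_leafP lx xn.
rewrite (@next_filter_lt _ _ x (Ordinal (yn : next_leaf x < n.+1))) ?leaf_codeE //= => z.
rewrite leaf_codeE leqNgt => lz xz; apply/negP; rewrite /next_leaf => zy.
have [zE|zE] : z = x.+1 :> nat \/ z = x.+2 :> nat.
  by move: zy; case: ifP => _; [|case: ifP => _]; lia.
  by move: zy; rewrite -zE lz /=; lia.
by move: zy; rewrite -zE lz; case: ifP => _; lia.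
Qed.

Let first_leaf := find leaf_code (iota 0 s).

Let first_leafP : [/\ first_leaf < s, leaf_code first_leaf &
  forall v, leaf_code v -> first_leaf <= v].
Proof.
have hasl : has leaf_code (iota 0 s) by case/and5P: good => _ _ _ _ /and5P[_ _ _ ->].
have lt : first_leaf < s by move: hasl; rewrite has_find size_iota.
split=> //; first by have := nth_find 0 hasl; rewrite nth_iota.
move=> v lv; rewrite leqNgt; apply/negP => vf.
by have := before_find 0 vf; rewrite nth_iota ?(ltn_trans vf lt) // lv.
Qed.

Let last_leaf : leaf_code n.
Proof. by rewrite leaf_tail ?n_mod // /n; lia. Qed.

Let next_last (x : 'I_n.+1) : x = n :> nat -> next c x = first_leaf :> nat.
Proof.
move=> xn; have [fs lf fmin] := first_leafP; have fn : first_leaf < n.+1 by rewrite /n; lia.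
rewrite (@next_filter_wrap _ _ x (Ordinal fn)) ?leaf_codeE //= ?xn ?last_leaf // => z.
by rewrite leaf_codeE => /fmin->; rewrite /= -ltnS ltn_ord.
Qed.

(** The cases are: the last leaf, whose successors are the first two leaves; the
    leaf before it; the leaves of the prefix; and the other leaves. *)
Let separation (x : 'I_n.+1) : childless par x ->
  [/\ par (par x) != par (next c x), par (par (next c x)) != par x
    & par (next c (next c x)) != par x].
Proof.
rewrite leaf_codeE => lx; have [fs lf _] := first_leafP.
have tail v : s <= v -> 0 < (v - s) %% 3 -> par v = v - (v - s) %% 3 /\ par (par v) = 0.
  move=> sv v3; have [[] //|[_ pv]] := par_tail sv; first by lia.
  by split=> //; rewrite pv; have := @par_tail (v - (v - s) %% 3); lia.
have := ltn_ord x; rewrite ltnS leq_eqVlt => /predU1P[xn|xn].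
  have fn : first_leaf < n by move: nE; lia.
  have e1 := next_last xn.
  have e2 : next c (next c x) = next_leaf first_leaf :> nat.
    by rewrite next_ord e1.
  have sn : s <= n by move: nE; lia.
  have [] := tail n sn; rewrite n_mod // => pn ppn.
  have [_ _ pf] := prefixP fs lf.
  rewrite e2 e1 xn ppn pn; split; first by rewrite neq_ltn pf.
    by have := par_le first_leaf; have := par_le (par first_leaf); move: nE; lia.
  have : next_leaf first_leaf <= first_leaf + 3.
    by rewrite /next_leaf; case: ifP => _; [|case: ifP => _]; lia.
  by have := par_le (next_leaf first_leaf); move: nE; lia.
have e1 := next_ord lx xn; have [ly /andP[xy yn]] := next_leafP lx xn.
move: yn; rewrite leq_eqVlt => /predU1P[yn|yn].
  have e2 : next c (next c x) = first_leaf :> nat by rewrite next_last // e1.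
  have sx : s <= x.
    rewrite leqNgt; apply/negP => xs; move: yn; rewrite /next_leaf.
    by case: ifP => _; [|case: ifP => _]; move: nE; lia.
  have [[x3 yE]|[x3 yE]] := next_leaf_tail sx lx; last by move: n_mod; lia.
  have [] := tail x sx; rewrite x3 // => px ppx.
  have [] := tail n; rewrite ?n_mod // ?(leq_trans sx) ?(ltnW xn) // => pn ppn.
  rewrite e2 e1 yn ppx ppn px pn; have := par_le first_leaf.
  by move: yn; rewrite yE /n => xE; split; lia.
have e2 : next c (next c x) = next_leaf (next_leaf x) :> nat.
  by rewrite next_ord e1.
rewrite e2 e1; have [xs|sx] := ltnP x s.
  by have [_ /and3P[]] := prefixP xs lx.
have sy : s <= next_leaf x by apply: leq_trans (ltnW xy).
have [yn' /andP[yz _]] := next_leafP ly yn.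
have sz : s <= next_leaf (next_leaf x) by apply: leq_trans (ltnW yz).
have stepx := next_leaf_tail sx lx; have stepy := next_leaf_tail sy ly.
have [|px ppx] := tail _ sx; first by lia.
have [|py ppy] := tail _ sy; first by lia.
have [|pz _] := tail _ sz; first by lia.
by rewrite ppx ppy px py pz; split; lia.
Qed.

Lemma extremal_graph : exists H : {set {set 'I_n.+1}},
  [/\ halin H, free_of (cycle_graph 4) H &
      #|H| = n + (count leaf_code (iota 0 s) + 2 * m)].
Proof.
have n_gt0 : 0 < n by rewrite /n; lia.
have size_c : 4 < size c.
  have hasl : 0 < count leaf_code (iota 0 s).
    by rewrite -has_count; case/and5P: good => _ _ _ _ /and5P[_ _ _ ->].
  by rewrite size_preorder_leaves; lia.
exists (preorder_tree n par :|: cycle_edges c); split.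
- exact: preorder_halin.
- by apply: preorder_C4free => // x; apply: separation.
- by rewrite card_preorder_halin // size_preorder_leaves.
Qed.

End Extremal.

Lemma halin_exE n e (H : {set {set 'I_n}}) :
    3 * e <= 5 * (n - 1) < 3 * e.+1 ->
    halin H -> free_of (cycle_graph 4) H -> #|H| = e ->
  halin_ex n (cycle_graph 4) = e.
Proof.
move=> bnd hH fH cH; apply/eqP; rewrite eqn_leq; apply/andP; split.
  apply/bigmax_leqP => G /asboolP[hG fG].
  by have := halin_C4free_edges hG fG; lia.
by rewrite -cH; apply: leq_bigmax_cond; apply/asboolP.
Qed.

Theorem theorem3 (n : nat) (hn : 16 <= n) :
  [/\ 3 %| n - 1 -> halin_ex n (cycle_graph 4) = 5 * ((n - 1) %/ 3),
      3 %| n - 2 -> halin_ex n (cycle_graph 4) = 5 * ((n - 2) %/ 3) + 1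
    & 3 %| n - 3 -> halin_ex n (cycle_graph 4) = 5 * ((n - 3) %/ 3) + 3].
Proof.
have build pre m e : good_prefix pre -> 1 < m -> n = size pre + 3 * m ->
    e = n - 1 + (count (leaf_code pre) (iota 0 (size pre)) + 2 * m) ->
    3 * e <= 5 * (n - 1) < 3 * e.+1 -> halin_ex n (cycle_graph 4) = e.
  move=> good m1 nE eE bnd; have [H [hH fH cH]] := extremal_graph good m1.
  have e1 : (size pre + 3 * m).-1.+1 = n by lia.
  move: H hH fH cH; rewrite e1 => H hH fH cH.
  by apply: (halin_exE bnd hH fH); rewrite cH eE; lia.
split=> /dvdnP[k kE].
(* The hub and one cherry. *)
- apply: (build [:: 0; 0; 1; 1] (k - 1)) => //=; lia.
(* The hub and a second hub, the vertex 1, with two cherries. *)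
- apply: (build [:: 0; 0; 1; 2; 2; 1; 5; 5] (k - 2)) => //=; lia.
(* The hub and the vertex 1, which has the single leaf 2, then the second hub 3
   with two cherries, then the pair of leaves 10 and 11. *)
- apply: (build [:: 0; 0; 1; 1; 3; 4; 4; 3; 7; 7; 1; 1] (k - 3)) => //=; lia.
Qed.
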